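(* Let $D$ be a sharp domain. Then for each maximal ideal $M$ of $D$, the localization $D_M$ is a valuation domain whose value group is a complete subgroup of the reals. In particular, a sharp domain is a Prüfer domain of (Krull) dimension $\leq 1$.
   Context: All rings are integral domains (commutative, unitary, without zero-divisors). A domain $D$ is called a sharp domain if whenever $I \supseteq AB$ with $I, A, B$ nonzero ideals of $D$, there exist ideals $A' \supseteq A$ and $B' \supseteq B$ of $D$ such that $I = A'B'$. The value group of a valuation domain ''is a complete subgroup of the reals'' means that it is isomorphic, as an ordered abelian group, to a subgroup of $(\mathbb{R},+)$ in which every nonempty subset bounded below has an infimum (in that subgroup); equivalently, it is order-isomorphic to $0$, $\mathbb{Z}$ or $\mathbb{R}$. A field is regarded as a valuation domain with trivial value group $0$. *)

(* Defs.v *)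
From HB Require Import structures.
From mathcomp Require Import all_boot all_order all_algebra.
From mathcomp Require Import boolp classical_sets reals.

Set Implicit Arguments.
Unset Strict Implicit.
Unset Printing Implicit Defensive.

Import Order.TTheory GRing.Theory Num.Theory.
Local Open Scope classical_set_scope.
Local Open Scope ring_scope.

Notation "x %:F" := (@FracField.tofrac _ x) : ring_scope.

Section Ideals.
Variable D : idomainType.

(* The unit ideal is allowed, unlike in [idealr_closed], which is about proper
   ideals only. *)
Definition ideal (I : set D) : Prop :=
  [/\ I 0,
      forall x y, I x -> I y -> I (x + y)
    & forall a x, I x -> I (a * x)].

Definition nonzero_ideal (I : set D) : Prop := ideal I /\ I <> [set 0].

Definition proper_ideal (I : set D) : Prop := ideal I /\ I <> setT.

Definition prime_ideal (P : set D) : Prop :=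
  proper_ideal P /\ forall x y, P (x * y) -> P x \/ P y.

Definition maximal_ideal (M : set D) : Prop :=
  proper_ideal M /\ forall J, proper_ideal J -> M `<=` J -> J = M.

Definition generated_ideal (n : nat) (g : 'I_n -> D) : set D :=
  [set x | exists c : 'I_n -> D, x = \sum_(i < n) c i * g i].

Definition finitely_generated (I : set D) : Prop :=
  exists (n : nat) (g : 'I_n -> D), I = generated_ideal g.

End Ideals.

(* Product of ideals, or of D-submodules of a ring extension of D: finite sums
   of products. *)
Definition ideal_mul (T : nzRingType) (A B : set T) : set T :=
  [set x | exists (n : nat) (a b : 'I_n -> T),
     [/\ forall i, A (a i), forall i, B (b i) & x = \sum_(i < n) a i * b i]].

Definition sharp_domain (D : idomainType) : Prop :=
  forall I A B : set D,
    nonzero_ideal I -> nonzero_ideal A -> nonzero_ideal B ->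
    ideal_mul A B `<=` I ->
    exists A' B' : set D,
      [/\ ideal A', ideal B', A `<=` A', B `<=` B' & I = ideal_mul A' B'].

Section MaximalPrime.
Variable D : idomainType.

Lemma maximal_ideal_prime (M : set D) : maximal_ideal M -> prime_ideal M.
Proof.
move=> [[[M0 MD MM] MT] Mmax]; split=> // x y Mxy.
case: (pselect (M x)) => Mx; [by left|right].
pose J : set D := [set z | exists m a, M m /\ z = m + a * x].
have JI : ideal J.
  split.
  - by exists 0, 0; split=> //; rewrite mul0r addr0.
  - move=> _ _ [m [a [Mm ->]]] [m' [a' [Mm' ->]]].
    by exists (m + m'), (a + a'); split; [exact: MD|rewrite mulrDl addrACA].
  - move=> b _ [m [a [Mm ->]]].
    by exists (b * m), (b * a); split; [exact: MM|rewrite mulrDr mulrA].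
have MJ : M `<=` J by move=> m Mm; exists m, 0; rewrite mul0r addr0.
have Jx : J x by exists 0, 1; rewrite mul1r add0r.
have JT : J = setT.
  by apply: contrapT => JT; apply: Mx; rewrite -(Mmax J).
have : J 1 by rewrite JT.
move=> [m [a [Mm e]]].
have -> : y = y * m + a * (x * y).
  by rewrite mulrA (mulrC y) -mulrDl -e mul1r.
by apply: MD; apply: MM.
Qed.

End MaximalPrime.

(* The localization D_P at a prime ideal P, as the subring {a / s | s \notin P}
   of the fraction field of D.  The primality proof is a phantom parameter, from
   which the ring structure of the localization is inferred. *)
Definition loc_pred (D : idomainType) (P : set D) of prime_ideal P
    : {pred {fraction D}} :=
  fun x => `[< exists a s : D, ~ P s /\ x = a%:F / s%:F >].

Section Localization.
Variables (D : idomainType) (P : set D) (hP : prime_ideal P).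
Local Notation loc_pred := (loc_pred hP).

Lemma loc_notin1 : ~ P 1.
Proof.
case: hP => [[[_ _ PM] PT] _] P1; apply: PT; apply/seteqP; split=> // x _.
by rewrite -(mulr1 x); apply: PM.
Qed.

Lemma loc_notinM s t : ~ P s -> ~ P t -> ~ P (s * t).
Proof. by case: hP => _ PP Ps Pt /PP[]. Qed.

Lemma loc_denom_neq0 s : ~ P s -> s%:F != 0.
Proof.
by move=> Ps; rewrite tofrac_eq0; apply/eqP => s0; apply: Ps; rewrite s0;
  case: hP => [[[]]].
Qed.

Lemma loc_subring_closed : subring_closed loc_pred.
Proof.
split.
- by apply/asboolP; exists 1, 1; split; [exact: loc_notin1|rewrite divff// oner_eq0].
- move=> _ _ /asboolP[a [s [Ps ->]]] /asboolP[b [t [Pt ->]]]; apply/asboolP.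
  exists (a * t - b * s), (s * t); split; first exact: loc_notinM.
  have s0 := loc_denom_neq0 Ps; have t0 := loc_denom_neq0 Pt.
  by rewrite -[X in _ + X]mulNr addf_div// rmorphB !rmorphM /= mulNr.
- move=> _ _ /asboolP[a [s [Ps ->]]] /asboolP[b [t [Pt ->]]]; apply/asboolP.
  exists (a * b), (s * t); split; first exact: loc_notinM.
  by rewrite !rmorphM /= mulf_div.
Qed.

HB.instance Definition _ :=
  GRing.isSubringClosed.Build {fraction D} loc_pred loc_subring_closed.

Record localization : Type :=
  Localization { loc_val : {fraction D}; loc_valP : loc_val \in loc_pred }.

HB.instance Definition _ := [isSub for loc_val].
HB.instance Definition _ := [Choice of localization by <:].
HB.instance Definition _ :=
  [SubChoice_isSubComNzRing of localization by <:].

Definition loc_unit : pred localization := fun x =>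
  (val x != 0) && ((val x)^-1 \in loc_pred).

Definition loc_inv (x : localization) : localization :=
  if loc_unit x then insubd x (val x)^-1 else x.

Lemma loc_mulVr : {in loc_unit, left_inverse 1 loc_inv *%R}.
Proof.
move=> x xU; apply: val_inj; rewrite rmorphM rmorph1 /= /loc_inv.
move: (xU); rewrite -topredE /= => xU'; rewrite xU'.
by case/andP: xU' => x0 xV; rewrite insubdK// mulVf.
Qed.

Lemma loc_unitPl (x y : localization) : y * x = 1 -> loc_unit x.
Proof.
move=> /(congr1 val); rewrite rmorphM rmorph1 /= => yx.
have x0 : val x != 0.
  by apply: contra_eq_neq yx => ->; rewrite mulr0 eq_sym oner_eq0.
rewrite /loc_unit x0 /=; have -> : (val x)^-1 = val y; last exact: valP.
by rewrite -[LHS]mul1r -yx mulfK.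
Qed.

Lemma loc_inv_out : {in [predC loc_unit], loc_inv =1 id}.
Proof. by move=> x; rewrite inE -topredE /= /loc_inv => /negbTE ->. Qed.

HB.instance Definition _ := GRing.ComNzRing_hasMulInverse.Build localization
  loc_mulVr loc_unitPl loc_inv_out.

Lemma loc_integral : GRing.integral_domain_axiom localization.
Proof.
move=> x y /(congr1 val); rewrite rmorphM rmorph0 /= => /eqP.
by rewrite mulf_eq0 -!(inj_eq val_inj) rmorph0.
Qed.

HB.instance Definition _ :=
  GRing.ComUnitRing_isIntegral.Build localization loc_integral.

End Localization.

(* In terms of the fraction field: x or x^-1 is in V for every nonzero x. *)
Definition valuation_domain (V : idomainType) : Prop :=
  forall x : {fraction V}, x != 0 ->
    (exists a : V, x = a%:F) \/ (exists a : V, x^-1 = a%:F).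

(* The value group K^* / V^* (K the fraction field of V), written additively
   and ordered by  x V^* <= y V^*  iff  y / x \in V.  The construction makes
   sense for every domain V (it is then the group of divisibility of V); the
   order is total exactly when V is a valuation domain. *)
Section ValueGroup.
Variable V : idomainType.
Local Notation K := {fraction V}.

Record nzfrac : Type := NzFrac { nzfrac_val : K; nzfrac_neq0 : nzfrac_val != 0 }.

HB.instance Definition _ := [isSub for nzfrac_val].
HB.instance Definition _ := [Choice of nzfrac by <:].

Definition nzfrac1 : nzfrac := NzFrac (oner_neq0 K).
Definition nzfracM (x y : nzfrac) : nzfrac :=
  NzFrac (mulf_neq0 (nzfrac_neq0 x) (nzfrac_neq0 y)).
Lemma nzfracV_subproof (x : nzfrac) : (val x)^-1 != 0.
Proof. by rewrite invr_eq0 nzfrac_neq0. Qed.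
Definition nzfracV (x : nzfrac) : nzfrac := NzFrac (nzfracV_subproof x).

Definition same_value (x y : nzfrac) : bool :=
  `[< exists2 u : V, u \is a GRing.unit & val y = u%:F * val x >].

Definition value_le (x y : nzfrac) : bool :=
  `[< exists a : V, val y = a%:F * val x >].

Lemma same_value_refl : reflexive same_value.
Proof. by move=> x; apply/asboolP; exists 1; rewrite ?unitr1// rmorph1 mul1r. Qed.

Lemma tofrac_unit_neq0 (u : V) : u \is a GRing.unit -> u%:F != 0.
Proof. by move=> uU; rewrite tofrac_eq0; apply: contraTneq uU => ->; rewrite unitr0. Qed.

Lemma same_value_sym : symmetric same_value.
Proof.
have H x y : same_value x y -> same_value y x.
  move=> /asboolP[u uU e]; apply/asboolP; exists u^-1; first by rewrite unitrV.
  by rewrite e mulrA -rmorphM mulVr// rmorph1 mul1r.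
by move=> x y; apply/idP/idP; apply: H.
Qed.

Lemma same_value_trans : transitive same_value.
Proof.
move=> y x z /asboolP[u uU eu] /asboolP[v vU ev]; apply/asboolP.
by exists (v * u); [rewrite unitrM vU|rewrite ev eu mulrA -rmorphM].
Qed.

Canonical same_value_equiv :=
  EquivRel same_value same_value_refl same_value_sym same_value_trans.

Local Open Scope quotient_scope.

Definition value_group := {eq_quot same_value_equiv}.

HB.instance Definition _ := Choice.on value_group.
HB.instance Definition _ := EqQuotient.on value_group.

Definition value (x : nzfrac) : value_group := \pi_value_group x.

Lemma valueP (x y : nzfrac) : reflect (value x = value y) (same_value x y).
Proof. by apply: (iffP idP) => /eqmodP. Qed.

Lemma valueK (g : value_group) : value (repr g) = g.
Proof. exact: reprK. Qed.

Definition vg_zero : value_group := value nzfrac1.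
Definition vg_add (g h : value_group) : value_group :=
  value (nzfracM (repr g) (repr h)).
Definition vg_opp (g : value_group) : value_group := value (nzfracV (repr g)).

Lemma vg_addE x y : vg_add (value x) (value y) = value (nzfracM x y).
Proof.
apply/valueP/asboolP.
have /valueP/asboolP[u uU /= eu] := valueK (value x).
have /valueP/asboolP[v vU /= ev] := valueK (value y).
by exists (u * v); [rewrite unitrM uU|rewrite /= eu ev rmorphM mulrACA].
Qed.

Lemma vg_oppE x : vg_opp (value x) = value (nzfracV x).
Proof.
apply/valueP/asboolP.
have /valueP/asboolP[u uU /= eu] := valueK (value x).
exists u^-1; first by rewrite unitrV.
rewrite /= eu invfM; congr (_ * _).
have ->: (u^-1)%:F = (u%:F)^-1.
  apply: (mulIf (tofrac_unit_neq0 uU)).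
  by rewrite -rmorphM mulVr// rmorph1 mulVf ?tofrac_unit_neq0.
by [].
Qed.

Lemma vg_addA : associative vg_add.
Proof.
move=> g h k; rewrite -(valueK g) -(valueK h) -(valueK k) !vg_addE.
by congr value; apply: val_inj; rewrite /= mulrA.
Qed.

Lemma vg_addC : commutative vg_add.
Proof.
move=> g h; rewrite -(valueK g) -(valueK h) !vg_addE.
by congr value; apply: val_inj; rewrite /= mulrC.
Qed.

Lemma vg_add0 : left_id vg_zero vg_add.
Proof.
move=> g; rewrite -(valueK g) vg_addE.
by congr value; apply: val_inj; rewrite /= mul1r.
Qed.

Lemma vg_addN : left_inverse vg_zero vg_opp vg_add.
Proof.
move=> g; rewrite -(valueK g) vg_oppE vg_addE.
by congr value; apply: val_inj; rewrite /= mulVf// nzfrac_neq0.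
Qed.

HB.instance Definition _ :=
  GRing.isZmodule.Build value_group vg_addA vg_addC vg_add0 vg_addN.

Definition vg_le (g h : value_group) : bool := value_le (repr g) (repr h).

Lemma vg_leE x y : vg_le (value x) (value y) = value_le x y.
Proof.
have /valueP/asboolP[u uU /= eu] := valueK (value x).
have /valueP/asboolP[v vU /= ev] := valueK (value y).
have u0 := tofrac_unit_neq0 uU; have v0 := tofrac_unit_neq0 vU.
apply/asboolP/asboolP => -[a /= e].
- exists (v * a * u^-1).
  by rewrite ev e eu !mulrA -!rmorphM divrK.
- exists (v^-1 * a * u); apply: (mulfI v0).
  by rewrite -ev e eu !mulrA -!rmorphM mulrA mulVKr ?rmorphM ?mulrA.
Qed.

Lemma vg_le_refl : reflexive vg_le.
Proof.
move=> g; rewrite -(valueK g) vg_leE; apply/asboolP.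
by exists 1; rewrite rmorph1 mul1r.
Qed.

Lemma vg_le_anti : antisymmetric vg_le.
Proof.
move=> g h; rewrite -(valueK g) -(valueK h) !vg_leE => /andP[].
set x := repr g; set y := repr h.
move=> /asboolP[a ea] /asboolP[b eb]; apply/valueP/asboolP; exists a => //.
apply/unitrPr; exists b; apply/eqP; rewrite -tofrac_eq rmorphM rmorph1.
apply/eqP/(mulIf (nzfrac_neq0 y)); rewrite mul1r -mulrA.
by rewrite -[nzfrac_val y]/(val y) -eb -ea.
Qed.

Lemma vg_le_trans : transitive vg_le.
Proof.
move=> h g k; rewrite -(valueK g) -(valueK h) -(valueK k) !vg_leE.
move=> /asboolP[a ea] /asboolP[b eb]; apply/asboolP; exists (b * a).
by rewrite eb ea mulrA rmorphM.
Qed.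

HB.instance Definition _ := Order.Le_isPOrder.Build ring_display value_group
  vg_le_refl vg_le_anti vg_le_trans.

End ValueGroup.

(* Bounds and infima are taken inside G. *)
Definition complete_subgroup (R : realType) (G : set R) : Prop :=
  zmod_closed [in G] /\
  forall S : set R, S `<=` G -> S !=set0 ->
    (exists2 b, G b & lbound S b) ->
    exists m, [/\ G m, lbound S m & forall b, G b -> lbound S b -> b <= m].

Definition isomorphic_to_complete_subgroup
    (R : realType) (G : porderZmodType) : Prop :=
  exists f : {additive G -> R},
    {mono f : x y / x <= y} /\ complete_subgroup (range f).

(* J is a fractional ideal: a D-submodule of the fraction field with a common
   denominator d. *)
Definition fractional_ideal (D : idomainType) (J : set {fraction D}) : Prop :=
  [/\ J 0,
      forall x y, J x -> J y -> J (x + y),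
      forall (a : D) x, J x -> J (a%:F * x)
    & exists2 d : D, d != 0 &
        forall x, J x -> exists a : D, d%:F * x = a%:F].

Definition invertible_ideal (D : idomainType) (I : set D) : Prop :=
  exists2 J : set {fraction D}, fractional_ideal J &
    ideal_mul [set a%:F | a in I] J = range (fun a : D => a%:F).

Definition prufer_domain (D : idomainType) : Prop :=
  forall I : set D, nonzero_ideal I -> finitely_generated I ->
    invertible_ideal I.

(* There is no chain P_0 < ... < P_(n+1) of n + 2 prime ideals. *)
Definition krull_dim_le (D : idomainType) (n : nat) : Prop :=
  ~ exists P : 'I_n.+2 -> set D,
      (forall i, prime_ideal (P i)) /\
      (forall i j : 'I_n.+2, (i < j)%N -> P i `<` P j).

(* Main.v *)
Require Import Defs.
From HB Require Import structures.
From mathcomp Require Import all_boot all_order all_algebra.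
From mathcomp Require Import boolp classical_sets reals.
From mathcomp Require Import ring lra.

(** The argument is local. Contraction to [D] followed by extension is the
    identity on ideals of a localization, so sharpness passes to each [D_M]
    ([loc_sharp]); it remains to study a local sharp domain [V].

    In [V], greatest common divisors of arbitrary nonzero families exist
    ([setgcd_exists]). Given such a family [S] and a nonzero [x] in [S], let
    [A] be the set of elements divisible by all common divisors of [S], and
    [B = (x V : A)]. Then [A B] is contained in [x V], so sharpness factors
    [x V], and since [V] is local the factors are principal, say [x = a b] with
    [A] inside [a V] and [B] inside [b V]. Then [a] is the wanted divisor. This
    one fact is used three times.

    First, it reduces comparability of two elements to the case of coprime
    elements [x], [y]. If both were nonunits, sharpness would factor the ideal
    [(x^2, y)], which contains [(x, y)^2], into two proper ideals containing
    [x], and this is incompatible with coprimality ([no_coprime_nonunits]).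
    Hence divisibility in [V] is a total order and [V] is a valuation domain.

    Second, in terms of values, a greatest common divisor is an infimum
    ([vg_inf]): the value group is a totally ordered group in which nonempty
    sets bounded below have infima. Such a group is archimedean, and for a fixed
    [e > 0] the cuts [m / n] with [m e <= n g] embed it in the reals
    ([complete_ordered_group_real]).

    Third, it shows that the powers of a nonunit are not bounded by a nonzero
    element ([divides_exp]), which excludes a prime strictly between zero and
    the maximal ideal ([locally_archimedean_dim1]). Finally, a finitely
    generated ideal is invertible because it is so at each maximal ideal
    ([locally_valuation_prufer]). *)

Set Implicit Arguments.
Unset Strict Implicit.
Unset Printing Implicit Defensive.

Import Order.TTheory GRing.Theory Num.Theory.
Local Open Scope classical_set_scope.
Local Open Scope ring_scope.

(** * Divisibility and coprimality in a domain *)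

Section Divisibility.
Variable V : idomainType.
Implicit Types a b c d s x y : V.

Definition divides a b : Prop := exists c, b = c * a.

Lemma divides_refl a : divides a a.
Proof. by exists 1; rewrite mul1r. Qed.

Lemma divides_trans b a c : divides a b -> divides b c -> divides a c.
Proof. by move=> [r ->] [s ->]; exists (s * r); rewrite mulrA. Qed.

Lemma divides_mull a s : divides a (s * a).
Proof. by exists s. Qed.

Lemma divides_mulr a s : divides a (a * s).
Proof. by exists s; rewrite mulrC. Qed.

Lemma divides_mul2l s a b : s != 0 -> divides (s * a) (s * b) <-> divides a b.
Proof.
move=> s0; split=> [[r e]|[r ->]]; exists r; last by rewrite mulrCA.
by apply: (mulfI s0); rewrite e mulrCA.
Qed.

Lemma divides_unitMl u a b : u \is a GRing.unit ->
  divides a (u * b) <-> divides a b.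
Proof.
move=> uU; split=> -[r e]; last by exists (u * r); rewrite e mulrA.
by exists (u^-1 * r); rewrite -mulrA -e mulKr.
Qed.

Lemma divides_unit u a : u \is a GRing.unit -> divides u a.
Proof. by move=> uU; exists (a * u^-1); rewrite divrK. Qed.

Lemma divides1_unit a : divides a 1 -> a \is a GRing.unit.
Proof. by move=> [r e]; apply/unitrPr; exists r; rewrite mulrC -e. Qed.

(** The residue of [d] is regular modulo [c]. For nonzero [c] in a GCD
    domain this is the absence of common nonunit factors, but the present form
    is preserved by the manipulations below in every domain. *)
Definition coprime_elt c d : Prop := forall s, divides c (s * d) -> divides c s.

Lemma coprime_elt_sym c d : c != 0 -> coprime_elt c d -> coprime_elt d c.
Proof.
move=> c0 cd s [t e].
have [t' et] : divides c t by apply: cd; rewrite -e; exists s.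
by exists t'; apply: (mulfI c0); rewrite mulrC e et mulrAC mulrC.
Qed.

Lemma coprime_eltMr c d e :
  coprime_elt c d -> coprime_elt c e -> coprime_elt c (d * e).
Proof. by move=> cd ce s; rewrite mulrA => /ce/cd. Qed.

Lemma coprime_elt_dvdl a c d :
  c != 0 -> divides a c -> coprime_elt c d -> coprime_elt a d.
Proof.
move=> c0 [b e] cd s [t es].
have b0 : b != 0 by apply: contraNneq c0 => b0; rewrite e b0 mul0r.
rewrite -(divides_mul2l _ _ b0) -e; apply: cd.
by exists t; rewrite -mulrA es e mulrCA.
Qed.

Lemma coprime_elt_unit c d : coprime_elt c d -> divides c d ->
  c \is a GRing.unit.
Proof. by move=> cd cdvd; apply/divides1_unit/cd; rewrite mul1r. Qed.

(** Modulo [c], the element [u * c + v * d] is a unit times [d]. *)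
Lemma coprime_elt_lin c d u v : v \is a GRing.unit ->
  coprime_elt c d -> coprime_elt c (u * c + v * d).
Proof.
move=> vU cd s [t e]; apply: cd; apply/(divides_unitMl _ _ vU).
by exists (t - s * u); rewrite mulrBl -e; ring.
Qed.

(** Nonunits form an ideal. *)
Definition local_domain : Prop :=
  forall x y, x + y \is a GRing.unit ->
    x \is a GRing.unit \/ y \is a GRing.unit.

Lemma local_sum_unit (n : nat) (c : 'I_n -> V) : local_domain ->
  \sum_(i < n) c i \is a GRing.unit -> exists i, c i \is a GRing.unit.
Proof.
move=> loc; elim: n c => [|n IH] c; first by rewrite big_ord0 unitr0.
rewrite big_ord_recl => /loc[|/IH[i]]; first by exists ord0.
by exists (lift ord0 i).
Qed.

Lemma local_sub1_unit x : local_domain -> x \isn't a GRing.unit ->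
  1 - x \is a GRing.unit.
Proof.
move=> loc /negP xU.
by have /loc[] : (1 - x) + x \is a GRing.unit by rewrite subrK unitr1.
Qed.

End Divisibility.

Lemma divides_least (V : idomainType) n (f : 'I_n -> V) (i0 : 'I_n) :
  (forall x y : V, divides x y \/ divides y x) ->
  exists j, forall i, divides (f j) (f i).
Proof.
move=> total; case: n f i0 => [_ []//|n f _].
elim: n f => [|n IH] f.
  by exists ord0 => i; rewrite (ord1 i); apply: divides_refl.
have [j Hj] := IH (fun i => f (lift ord0 i)).
have [fj|fj] := total (f ord0) (f (lift ord0 j)).
  exists ord0 => i; have [i' ->|->] := unliftP ord0 i; last exact: divides_refl.
  exact: divides_trans fj (Hj i').
exists (lift ord0 j) => i; have [i' ->|->//] := unliftP ord0 i; exact: Hj.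
Qed.

(** * Ideals *)

Section IdealFacts.
Variable V : idomainType.
Implicit Types A B I : set V.

Definition principal_ideal (x : V) : set V := [set z | divides x z].

Lemma principal_ideal_ideal x : ideal (principal_ideal x).
Proof.
split=> [|y z [a ->] [b ->]|a y [b ->]].
- by exists 0; rewrite mul0r.
- by exists (a + b); rewrite mulrDl.
- by exists (a * b); rewrite mulrA.
Qed.

Lemma ideal_sum I n (c : 'I_n -> V) : ideal I -> (forall i, I (c i)) ->
  I (\sum_(i < n) c i).
Proof. by move=> [I0 ID _] Ic; elim/big_ind: _. Qed.

Lemma nonzero_idealP I x : ideal I -> I x -> x != 0 -> nonzero_ideal I.
Proof.
by move=> iI Ix x0; split=> // I0; move: Ix x0; rewrite I0 => ->; rewrite eqxx.
Qed.

Lemma nonzero_ideal_elt I : nonzero_ideal I -> exists2 x, I x & x != 0.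
Proof.
move=> [[I0 _ _] In0]; apply: contrapT => no; apply: In0.
apply/seteqP; split=> [x Ix|_ ->//]; apply/eqP/negPn/negP => x0.
by apply: no; exists x.
Qed.

Lemma ideal_mul_mem A B a b : A a -> B b -> ideal_mul A B (a * b).
Proof.
by move=> Aa Bb; exists 1%N, (fun=> a), (fun=> b); split; rewrite ?big_ord1.
Qed.

Lemma ideal_mul_sub A B I : ideal I ->
  (forall a b, A a -> B b -> I (a * b)) -> ideal_mul A B `<=` I.
Proof.
by move=> iI H _ [n [a [b [Aa Bb ->]]]]; apply: ideal_sum => // i; apply: H.
Qed.

(** A factorization of a principal ideal of a local domain is a factorization
    of its generator: writing [x] as a sum of products [a_i * b_i = c_i * x],
    some [c_i] is a unit. *)
Lemma local_principal_factor A B x : local_domain V -> x != 0 ->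
  ideal A -> ideal B -> principal_ideal x = ideal_mul A B ->
  exists a b, [/\ x = a * b, A `<=` principal_ideal a & B `<=` principal_ideal b].
Proof.
move=> loc x0 [A0 AD AM] [B0 BD BM] e.
have AB_x a b : A a -> B b -> divides x (a * b).
  by move=> Aa Bb; have := ideal_mul_mem Aa Bb; rewrite -e.
have : ideal_mul A B x by rewrite -e; apply: divides_refl.
move=> [n [a [b [Aa Bb ex]]]].
have /choice[c ec] : forall i, exists c, a i * b i = c * x.
  by move=> i; apply: AB_x.
have c1 : \sum_(i < n) c i = 1.
  apply: (mulIf x0); rewrite mul1r mulr_suml [RHS]ex.
  by apply: eq_bigr => i _.
have [i ciU] : exists i, c i \is a GRing.unit.
  by apply: local_sum_unit => //; rewrite c1 unitr1.
have ab : x = (c i)^-1 * a i * b i by rewrite -mulrA ec mulKr.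
have Aa' : A ((c i)^-1 * a i) by apply: AM.
have : (c i)^-1 * a i * b i != 0 by rewrite -ab.
rewrite mulf_eq0 negb_or => /andP[a0 b0].
exists ((c i)^-1 * a i), (b i); split=> // z Hz.
- have := AB_x _ _ Hz (Bb i); rewrite ab ![_ * b i]mulrC.
  by rewrite divides_mul2l.
- by have := AB_x _ _ Aa' Hz; rewrite ab divides_mul2l.
Qed.

End IdealFacts.

(** * Local sharp domains *)

Section LocalSharp.
Variable V : idomainType.
Hypotheses (sharp : sharp_domain V) (loc : local_domain V).
Implicit Types a b c d s x y : V.

(** For an ideal [A] containing [x] and [B = (x V : A)], the product [A B] lies
    in [x V]. The principal ideals [a V] and [b V] which sharpness puts around
    [A] and [B], with [x = a b], are as small as possible: a common divisor [c]
    of [A] has [x / c] in [B], so that [b] divides [x / c] and [c] divides [a]. *)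
Lemma setgcd_exists (S : set V) x : S x -> x != 0 ->
  exists d, forall c, (forall s, S s -> divides c s) <-> divides c d.
Proof.
move=> Sx x0.
(* The largest set with the same common divisors as [S]; it is an ideal. *)
pose A : set V := [set z | forall c, (forall s, S s -> divides c s) -> divides c z].
pose B : set V := [set t | forall z, A z -> divides x (t * z)].
have iA : ideal A.
  split=> [c _|y z Ay Az c cS|a y Ay c cS].
  - by exists 0; rewrite mul0r.
  - by have [_ D _] := principal_ideal_ideal c; apply: D; [apply: Ay|apply: Az].
  - by have [_ _ M] := principal_ideal_ideal c; apply: M; apply: Ay.
have iB : ideal B.
  split=> [z _|y z By Bz w Aw|a y By w Aw].
  - by exists 0; rewrite !mul0r.
  - have [_ D _] := principal_ideal_ideal x.
    by rewrite mulrDl; apply: D; [apply: By|apply: Bz].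
  - have [_ _ M] := principal_ideal_ideal x.
    by rewrite -mulrA; apply: M; apply: By.
have SA : S `<=` A by move=> s Ss c; apply.
have Bx : B x by move=> z _; apply: divides_mulr.
have [A' [B' [iA' iB' AA' BB' e]]] : exists A' B', [/\ ideal A', ideal B',
    A `<=` A', B `<=` B' & principal_ideal x = ideal_mul A' B'].
  apply: sharp; try exact: (@nonzero_idealP _ _ x).
  - apply: (@nonzero_idealP _ _ x) => //; first exact: principal_ideal_ideal.
    exact: divides_refl.
  - by apply: (@nonzero_idealP _ _ x) => //; apply: SA.
  - apply: ideal_mul_sub; first exact: principal_ideal_ideal.
    by move=> a b Aa Bb; rewrite mulrC; apply: Bb.
have [a [b [ex A'a B'b]]] := local_principal_factor loc x0 iA' iB' e.
exists a => c; split=> [cS|ca s Ss]; last first.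
  by apply: (divides_trans ca); apply/A'a/AA'/SA.
have [t et] := cS _ Sx.
have Bt : B t.
  move=> z Az; have [r ->] := Az _ cS.
  by exists r; rewrite et mulrCA.
have [r er] := B'b _ (BB' _ Bt); exists r.
have b0 : b != 0 by apply: contraNneq x0 => b0; rewrite ex b0 mulr0.
by apply: (mulIf b0); rewrite -ex et er mulrAC.
Qed.

Lemma gcd_exists x y : x != 0 ->
  exists d, forall c, divides c x /\ divides c y <-> divides c d.
Proof.
move=> x0; have [//|d Hd] := @setgcd_exists [set z | z = x \/ z = y] x _ x0.
  by left.
exists d => c; rewrite -Hd; split=> [[cx cy] s [->|->]//|H].
by split; apply: H; [left|right].
Qed.

(** The quotients of [x] and [y] by their greatest common divisor are coprime
    because multiplication by [s] commutes with greatest common divisors. *)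
Lemma coprime_cofactors x y : x != 0 ->
  exists d b c, [/\ x = d * b, y = d * c & coprime_elt b c].
Proof.
move=> x0; have [d Hd] := gcd_exists y x0.
have [[b ex] [c ey]] : divides d x /\ divides d y.
  by apply/Hd; apply: divides_refl.
exists d, b, c; split; rewrite 1?mulrC// => s bs.
have d0 : d != 0 by apply: contraNneq x0 => d0; rewrite ex d0 mulr0.
have b0 : b != 0 by apply: contraNneq x0 => b0; rewrite ex b0 mul0r.
have [->|s0] := eqVneq s 0; first by exists 0; rewrite mul0r.
have [e He] := gcd_exists (s * c) (mulf_neq0 s0 b0).
have [t et] : divides s e by apply/He; split; apply: divides_mulr.
have [] : divides e (s * b) /\ divides e (s * c).
  by apply/He; apply: divides_refl.
rewrite et [t * s]mulrC !divides_mul2l// => tb tc.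
have tU : t \is a GRing.unit.
  apply/divides1_unit; rewrite -(divides_mul2l _ _ d0) mulr1; apply/Hd.
  by split; rewrite ?ex ?ey [_ * d]mulrC divides_mul2l.
have /He : divides b (s * b) /\ divides b (s * c).
  by split=> //; apply: divides_mull.
by rewrite et divides_unitMl.
Qed.

(** The key step. The ideal [I] generated by [x^2] and [y] contains
    [(x, y)^2], hence [I = A B] with [x] in both factors. Neither factor is
    the whole ring, as [x] is not in [I]. Some product [a * b] can replace the
    generator [y] of [I], and it is again coprime to [x^2]. But [x * b] lies
    in [I = (x^2, a * b)], say [x * b = s' * x^2 + t' * a * b]; as [b] is
    coprime to [x^2] it divides [s'], and cancelling [b] shows that [a] divides
    [x]. Being coprime to [x^2], [a] is then a unit, a contradiction. *)
Lemma no_coprime_nonunits x y : x != 0 -> y != 0 -> coprime_elt x y ->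
  x \is a GRing.unit \/ y \is a GRing.unit.
Proof.
move=> x0 y0 xy; apply: contrapT => /not_orP[/negP xU /negP yU].
have nonunitM (z w : V) : w \isn't a GRing.unit -> z * w \isn't a GRing.unit.
  by move=> /negbTE wU; rewrite unitrM wU andbF.
have xx0 : x * x != 0 by rewrite mulf_neq0.
have cxxy : coprime_elt (x * x) y.
  apply: coprime_elt_sym => //.
  by apply: coprime_eltMr; apply: coprime_elt_sym.
pose I : set V := [set z | exists u v, z = u * (x * x) + v * y].
pose J : set V := [set z | exists u v, z = u * x + v * y].
have Ixx : I (x * x) by exists 1, 0; ring.
have Iy : I y by exists 0, 1; ring.
have Jx : J x by exists 1, 0; ring.
have iI : ideal I.
  split=> [|_ _ [u [v ->]] [u' [v' ->]]|a _ [u [v ->]]].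
  - by exists 0, 0; ring.
  - by exists (u + u'), (v + v'); ring.
  - by exists (a * u), (a * v); ring.
have iJ : ideal J.
  split=> [|_ _ [u [v ->]] [u' [v' ->]]|a _ [u [v ->]]].
  - by exists 0, 0; ring.
  - by exists (u + u'), (v + v'); ring.
  - by exists (a * u), (a * v); ring.
have Ix : ~ I x.
  move=> [u [v e]]; move: (yU); apply/negP/negPn.
  apply: (coprime_elt_unit (coprime_elt_sym x0 xy)).
  have xU' := local_sub1_unit loc (nonunitM u x xU).
  apply/(divides_unitMl _ _ xU'); exists v.
  by rewrite mulrBl mul1r {1}e; ring.
have [A [B [iA iB JA JB eI]]] : exists A' B' : set V, [/\ ideal A', ideal B',
    J `<=` A', J `<=` B' & I = ideal_mul A' B'].
  apply: sharp; try exact: (nonzero_idealP _ Jx).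
  - exact: nonzero_idealP Iy y0.
  - apply: ideal_mul_sub => // _ _ [u [v ->]] [u' [v' ->]].
    by exists (u * u'), (u * v' * x + v * u' * x + v * v' * y); ring.
have AB_I a b : A a -> B b -> I (a * b).
  by move=> Aa Bb; rewrite eI; apply: ideal_mul_mem.
have nA a : A a -> a \isn't a GRing.unit.
  move=> Aa; apply/negP => aU; apply: Ix; have [_ _ IM] := iI.
  by rewrite -(mulKr aU x); apply/IM/AB_I => //; apply: JB.
have nB b : B b -> b \isn't a GRing.unit.
  move=> Bb; apply/negP => bU; apply: Ix; have [_ _ IM] := iI.
  by rewrite -(mulrVK bU x) -mulrA mulrCA; apply/IM/AB_I => //; apply: JA.
have [a [b [u [v [Aa Bb eab vU]]]]] : exists a b u v,
    [/\ A a, B b, a * b = u * (x * x) + v * y & v \is a GRing.unit].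
  move: (Iy); rewrite {1}eI => -[n [a [b [Aa Bb ey]]]].
  have /choice[u /choice[v e]] : forall i, exists u, exists v,
      a i * b i = u * (x * x) + v * y.
    by move=> i; apply: AB_I.
  apply: contrapT => no.
  have vN : \sum_i v i \isn't a GRing.unit.
    apply/negP => /(local_sum_unit loc)[i viU]; apply: no.
    by exists (a i), (b i), (u i), (v i).
  move: (nonunitM x x xU); apply/negP/negPn; apply: (coprime_elt_unit cxxy).
  apply/(divides_unitMl _ _ (local_sub1_unit loc vN)).
  exists (\sum_i u i); rewrite mulrBl mul1r {1}ey (eq_bigr _ (fun i _ => e i)).
  by rewrite big_split /= -!mulr_suml addrK.
have cab : coprime_elt (x * x) (a * b) by rewrite eab; apply: coprime_elt_lin.
have [s [t exb]] : I (x * b) by apply: AB_I => //; apply: JA.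
(* Substituting [y = v^-1 * (a * b - u * x^2)]. *)
have [s' [t' ex]] : exists s' t', x * b = s' * (x * x) + t' * (a * b).
  exists (s - t * v^-1 * u), (t * v^-1).
  by rewrite eab exb mulrDr !mulrA divrK//; ring.
have ab0 : a * b != 0.
  apply: contraNneq (nonunitM x x xU) => ab0; apply: (coprime_elt_unit cab).
  by exists 0; rewrite ab0 mul0r.
have abxx := coprime_elt_sym xx0 cab.
have axx := coprime_elt_dvdl ab0 (divides_mulr a b) abxx.
have bxx := coprime_elt_dvdl ab0 (divides_mull b a) abxx.
have [r er] : divides b s'.
  by apply: bxx; exists (x - t' * a); rewrite mulrBl ex; ring.
have b0 : b != 0 by apply: contraNneq ab0 => ->; rewrite mulr0.
have ax : divides a x.
  have rxU : 1 - r * x \is a GRing.unit by apply/local_sub1_unit/nonunitM.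
  apply/(divides_unitMl _ _ rxU); exists t'; apply: (mulfI b0).
  by rewrite mulrBl mul1r mulrBr [b * x]mulrC ex er; ring.
move: (nA _ Aa); apply/negP/negPn; apply: (coprime_elt_unit axx).
exact: divides_trans ax (divides_mulr _ _).
Qed.

Lemma divides_total x y : divides x y \/ divides y x.
Proof.
have [->|x0] := eqVneq x 0; first by right; exists 0; rewrite mul0r.
have [->|y0] := eqVneq y 0; first by left; exists 0; rewrite mul0r.
have [d [b [c [ex ey bc]]]] := coprime_cofactors y x0.
move: x0 y0; rewrite {}ex {}ey !mulf_eq0 !negb_or => /andP[d0 b0] /andP[_ c0].
rewrite !divides_mul2l//.
by have [bU|cU] := no_coprime_nonunits b0 c0 bc; [left|right];
  apply: divides_unit.
Qed.

(** If no power of [y] were a multiple of [x], then [x] would be a multiple of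
    all of them, and the greatest common divisor of the quotients [x / y^n]
    would be a multiple of itself times [y]. *)
Lemma divides_exp x y : x != 0 -> y \isn't a GRing.unit ->
  exists n, divides x (y ^+ n).
Proof.
move=> x0 yU; apply: contrapT => no.
have dvdx n : divides (y ^+ n) x.
  by have [//|xyn] := divides_total (y ^+ n) x; case: no; exists n.
pose S := [set c | exists n, x = c * y ^+ n].
have Sx : S x by exists 0%N; rewrite mulr1.
have [d Hd] := setgcd_exists Sx x0.
have dS := (Hd d).2 (divides_refl d).
have d0 : d != 0.
  by have [r ex] := dS _ Sx; apply: contraNneq x0 => d0; rewrite ex d0 mulr0.
have y0 : y != 0.
  by apply: contraNneq x0 => y0; have [r] := dvdx 1; rewrite y0 mulr0 => ->.
have /Hd : forall s, S s -> divides (d * y) s.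
  move=> s [n en]; have [c ec] := dvdx n.+1.
  have [r er] : divides d c by apply: dS; exists n.+1.
  exists r; apply: (mulIf (expf_neq0 n y0)).
  by rewrite -en ec er exprS; ring.
by rewrite -[X in divides _ X]mulr1 divides_mul2l// => /divides1_unit; apply/negP.
Qed.

End LocalSharp.

(** * Localization at a prime ideal *)

Section LocalizationFacts.
Variables (D : idomainType) (P : set D) (hP : prime_ideal P).
Local Notation L := (localization hP).
Implicit Types (a s t : D) (z w : L).

Lemma loc_of_subproof a : a%:F \in loc_pred hP.
Proof.
by apply/asboolP; exists a, 1; split; [exact: loc_notin1 hP|rewrite rmorph1 divr1].
Qed.

Definition loc_of a : L := Localization (loc_of_subproof a).

Lemma loc_of_is_zmod_morphism : zmod_morphism loc_of.
Proof. by move=> a b; apply: val_inj; rewrite /= !rmorphB. Qed.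

Lemma loc_of_is_monoid_morphism : monoid_morphism loc_of.
Proof. by split=> [|a b]; apply: val_inj; rewrite /= ?rmorphM ?rmorph1. Qed.

HB.instance Definition _ :=
  GRing.isZmodMorphism.Build D L loc_of loc_of_is_zmod_morphism.
HB.instance Definition _ :=
  GRing.isMonoidMorphism.Build D L loc_of loc_of_is_monoid_morphism.

Lemma loc_of_inj : injective loc_of.
Proof. by move=> a b [/eqP]; rewrite tofrac_eq => /eqP. Qed.

Lemma loc_of_unit s : ~ P s -> loc_of s \is a GRing.unit.
Proof.
move=> Ps; have s0 := loc_denom_neq0 hP Ps.
have sP : s%:F^-1 \in loc_pred hP.
  by apply/asboolP; exists 1, s; rewrite rmorph1 mul1r.
apply/unitrPr; exists (Localization sP); apply: val_inj.
by rewrite rmorphM rmorph1 /= divff.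
Qed.

Lemma loc_numden z : exists a s, ~ P s /\ z * loc_of s = loc_of a.
Proof.
case: z => x xP; have /asboolP[a [s [Ps ex]]] := xP; exists a, s; split=> //.
by apply: val_inj; rewrite rmorphM /= ex divfK// (loc_denom_neq0 hP Ps).
Qed.

Lemma loc_unitE z a s : ~ P s -> z * loc_of s = loc_of a ->
  z \is a GRing.unit <-> ~ P a.
Proof.
move=> Ps e; have sU := loc_of_unit Ps; split=> [zU Pa|Pa]; last first.
  by have := loc_of_unit Pa; rewrite -e unitrM => /andP[].
have [b [t [Pt eb]]] := loc_numden z^-1.
have /loc_of_inj ets : loc_of (t * s) = loc_of (b * a).
  by rewrite !rmorphM /= -e -eb mulrACA mulVr// mul1r.
case: (hP) => -[[_ _ PM] _] PP.
by have /PP[] : P (t * s) by rewrite ets; apply: PM.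
Qed.

Lemma loc_local : local_domain L.
Proof.
move=> z w; have [a [s [Ps ez]]] := loc_numden z.
have [b [t [Pt ew]]] := loc_numden w.
have e : (z + w) * loc_of (s * t) = loc_of (t * a + s * b).
  by rewrite rmorphD !rmorphM /= -ez -ew; ring.
move/(loc_unitE (loc_notinM hP Ps Pt) e) => Pab.
apply: contrapT => /not_orP[/(loc_unitE Ps ez)/contrapT Pa].
move=> /(loc_unitE Pt ew)/contrapT Pb; apply: Pab.
by case: (hP) => -[[_ PD PM] _] _; apply: PD; apply: PM.
Qed.

Definition contraction (I : set L) : set D := [set a | I (loc_of a)].

Definition extension (A : set D) : set L :=
  [set z | exists a s, [/\ A a, ~ P s & z * loc_of s = loc_of a]].

Lemma contraction_nonzero (I : set L) :
  nonzero_ideal I -> nonzero_ideal (contraction I).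
Proof.
move=> nI; have [z Iz z0] := nonzero_ideal_elt nI.
have [[I0 ID IM] _] := nI; have [a [s [Ps e]]] := loc_numden z.
apply: (@nonzero_idealP _ _ a).
- split=> [|x y|c x]; rewrite /contraction /= ?rmorph0 ?rmorphD ?rmorphM//=.
  + exact: ID.
  + exact: IM.
- by rewrite /contraction /= -e mulrC; apply: IM.
- apply: contraNneq z0 => a0; move: e; rewrite a0 rmorph0 => /eqP.
  rewrite mulf_eq0 => /orP[//|/eqP s0]; exfalso.
  by move: (loc_of_unit Ps); rewrite s0 unitr0.
Qed.

Lemma extension_ideal (A : set D) : ideal A -> ideal (extension A).
Proof.
move=> [A0 AD AM]; split=> [|z w [a [s [Aa Ps ez]]] [b [t [Ab Pt ew]]]|w z].
- by exists 0, 1; split=> //; [exact: loc_notin1 hP|rewrite !rmorph0 mul0r].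
- exists (t * a + s * b), (s * t); split; [|exact: loc_notinM|].
  + by apply: AD; apply: AM.
  + by rewrite rmorphD !rmorphM /= -ez -ew; ring.
- move=> [a [s [Aa Ps ez]]]; have [b [t [Pt ew]]] := loc_numden w.
  exists (b * a), (t * s); split; [exact: AM|exact: loc_notinM|].
  by rewrite !rmorphM /= -ez -ew; ring.
Qed.

Lemma contraction_extension (I : set L) (A : set D) :
  contraction I `<=` A -> ideal I -> I `<=` extension A.
Proof.
move=> IA [_ _ IM] z Iz; have [a [s [Ps e]]] := loc_numden z.
by exists a, s; split=> //; apply: IA; rewrite /contraction /= -e mulrC; apply: IM.
Qed.

(** Contraction to [D] followed by extension is the identity on ideals of the
    localization, and extension commutes with products, so that a
    factorization found in [D] extends. *)
Lemma loc_sharp : sharp_domain D -> sharp_domain L.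
Proof.
move=> sharp I A B nI nA nB ABI.
have [iI _] := nI; have [iA _] := nA; have [iB _] := nB.
have [I0 ID IM] := iI.
have [||||A' [B' [iA' iB' AA' BB' e]]] :=
    sharp (contraction I) (contraction A) (contraction B).
- exact: contraction_nonzero.
- exact: contraction_nonzero.
- exact: contraction_nonzero.
- apply: ideal_mul_sub; first by have [] := contraction_nonzero nI.
  move=> a b Aa Bb; rewrite /contraction /= rmorphM /=.
  exact/ABI/ideal_mul_mem.
exists (extension A'), (extension B'); split; try exact: extension_ideal.
- exact: contraction_extension.
- exact: contraction_extension.
apply/seteqP; split=> [z Iz|]; last first.
  apply: ideal_mul_sub => // z w [a [s [Aa Ps ez]]] [b [t [Bb Pt ew]]].
  have : contraction I (a * b) by rewrite e; apply: ideal_mul_mem.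
  rewrite /contraction /= rmorphM /= -ez -ew => Izw.
  have stU : loc_of (s * t) \is a GRing.unit.
    exact/loc_of_unit/(loc_notinM hP).
  rewrite -(mulrVK stU (z * w)) -mulrA mulrCA rmorphM /=.
  by apply: IM; rewrite mulrACA.
have [a [s [Ps ez]]] := loc_numden z.
have : contraction I a by rewrite /contraction /= -ez mulrC; apply: IM.
rewrite e => -[n [f [g [Af Bg ea]]]].
exists n, (fun i => loc_of (f i) / loc_of s), (loc_of \o g); split=> [i|i|/=].
- by exists (f i), s; rewrite divrK//; apply: loc_of_unit.
- by exists (g i), 1; rewrite rmorph1 mulr1; split=> //; exact: loc_notin1 hP.
- apply: (mulIr (loc_of_unit Ps)); rewrite ez ea rmorph_sum mulr_suml.
  apply: eq_bigr => i _.
  by rewrite mulrAC divrK ?rmorphM//; apply: loc_of_unit.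
Qed.

Lemma loc_dividesP a b : divides (loc_of a) (loc_of b) <->
  exists2 s, ~ P s & divides a (s * b).
Proof.
split=> [[z e]|[s Ps [c e]]].
  have [c [s [Ps ez]]] := loc_numden z; exists s => //; exists c.
  by apply: loc_of_inj; rewrite !rmorphM /= e -ez; ring.
exists (loc_of c / loc_of s); apply: (mulrI (loc_of_unit Ps)).
by rewrite -rmorphM e rmorphM /= mulrA [_ * (_ / _)]mulrC divrK ?loc_of_unit.
Qed.

End LocalizationFacts.

(** * Order-complete groups are subgroups of the reals *)

Section CompleteOrderedGroup.
Variables (R : realType) (G : porderZmodType).
Hypothesis le_totalG : forall x y : G, x <= y \/ y <= x.
Hypothesis leD2lG : forall z x y : G, x <= y -> z + x <= z + y.
Hypothesis infG : forall S : set G, S !=set0 -> (exists b, lbound S b) ->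
  exists m, lbound S m /\ forall b, lbound S b -> b <= m.
Implicit Types (x y z e g h : G).

Lemma og_leD2l z x y : (z + x <= z + y) = (x <= y).
Proof.
by apply/idP/idP => [/(leD2lG (- z))|/leD2lG]; rewrite ?addKr.
Qed.

Lemma og_ltD2l z x y : (z + x < z + y) = (x < y).
Proof. by rewrite !lt_neqAle og_leD2l (inj_eq (addrI z)). Qed.

Lemma og_leD x y z w : x <= y -> z <= w -> x + z <= y + w.
Proof.
by move=> xy zw; rewrite (@le_trans _ _ (x + w)) ?og_leD2l// ![_ + w]addrC og_leD2l.
Qed.

Lemma og_nle x y : ~~ (x <= y) -> y < x.
Proof.
move=> xy; have [] := le_totalG x y => [|yx]; first by rewrite (negbTE xy).
by rewrite lt_neqAle yx andbT; apply: contraNneq xy => ->.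
Qed.

Lemma og_subr_gt0 x y : (0 < y - x) = (x < y).
Proof. by rewrite -[LHS](og_ltD2l x) addr0 addrC subrK. Qed.

Lemma og_oppr_ge0 x : (0 <= - x) = (x <= 0).
Proof. by rewrite -[LHS](og_leD2l x) addr0 subrr. Qed.

Lemma og_mulrn_le n x y : x <= y -> x *+ n <= y *+ n.
Proof. by move=> xy; elim: n => // n IH; rewrite !mulrS og_leD. Qed.

(** If all multiples of [e] stayed below [g], the infimum [m] of the multiples
    of [- e] would exist, and [m + e] would be another lower bound. *)
Lemma og_archimedean e g : 0 < e -> exists n, g < e *+ n.
Proof.
move=> e0; apply: contrapT => no.
have [||m [mS mM]] := infG (S := range (fun n : nat => - (e *+ n))).
- by exists (- (e *+ 0)), 0%N.
- exists (- g) => _ [n _ <-]; rewrite -(og_leD2l g) subrr -(og_leD2l (e *+ n)).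
  rewrite addr0 [_ + (g - _)]addrC subrK; apply/negPn/negP => /og_nle ?.
  by apply: no; exists n.
- have : m + e <= m.
    apply: mM => _ [n _ <-]; have := mS _ (ex_intro2 _ _ n.+1 I erefl).
    rewrite -(og_leD2l e) [m + e]addrC => /le_trans; apply.
    by rewrite mulrS opprD addrA subrr add0r.
  by rewrite -[X in _ <= X]addr0 og_leD2l => /(lt_le_trans e0); rewrite ltxx.
Qed.

Section Embedding.
Variable e : G.
Hypothesis e_gt0 : 0 < e.

Lemma og_mulrz_lt (k l : int) : k < l -> e *~ k < e *~ l.
Proof.
rewrite -subr_gt0 -og_subr_gt0 -mulrzBr.
case: (l - k) => // -[//|n] _; rewrite -pmulrn.
elim: n => [|n IH]; first by rewrite mulr1n.
by rewrite mulrS (lt_trans e_gt0)// -[X in X < _]addr0 og_ltD2l.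
Qed.

Lemma og_mulrz_le (k l : int) : (e *~ k <= e *~ l) = (k <= l).
Proof.
apply/idP/idP => [|]; last by rewrite le_eqVlt => /predU1P[->//|/og_mulrz_lt/ltW].
by apply: contraTT; rewrite -ltNge => /og_mulrz_lt lk; rewrite lt_geF.
Qed.

Lemma og_floor g : exists k : int, e *~ k <= g /\ g <= e *~ (k + 1).
Proof.
have [N hN] := og_archimedean (- g) e_gt0.
have [N' hN'] := og_archimedean g e_gt0.
have geN : e *~ (- N%:Z) < g.
  rewrite mulrNz -(og_ltD2l (e *~ N%:Z)) subrr -(og_ltD2l (- g)).
  by rewrite addr0 addrC addrK.
have : exists p : nat, g < e *~ (p%:Z - N%:Z).
  by exists (N' + N)%N; rewrite PoszD addrK.
move=> /ex_minnP[[|p]]; first by rewrite add0r lt_gtF.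
move=> gp pmin; exists (p%:Z - N%:Z); split; last first.
  by rewrite addrAC -PoszD addn1 ltW.
apply/negPn/negP => /og_nle/pmin; by rewrite ltnn.
Qed.

(** The real [g / e]. *)
Definition og_ratio g : R :=
  sup [set r : R | exists (m : int) (n : nat),
    e *~ m <= g *+ n.+1 /\ r = m%:~R / n.+1%:R].

Lemma og_cut (m q : int) n p g : e *~ m <= g *+ n.+1 -> g *+ p.+1 <= e *~ q ->
  m%:~R / n.+1%:R <= q%:~R / p.+1%:R :> R.
Proof.
move=> /(og_mulrn_le p.+1) mg /(og_mulrn_le n.+1) gq.
rewrite ler_pdivrMr ?ltr0Sn// mulrAC ler_pdivlMr ?ltr0Sn//.
rewrite !pmulrn -!intrM ler_int -og_mulrz_le !mulrzA -!pmulrn.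
by rewrite (le_trans mg)// -mulrnA mulnC mulrnA.
Qed.

Lemma og_ratio_has_sup g : has_sup [set r : R | exists (m : int) (n : nat),
    e *~ m <= g *+ n.+1 /\ r = m%:~R / n.+1%:R].
Proof.
have [k [kg gk]] := og_floor g; split.
  by exists (k%:~R / 1%:R), k, 0%N; rewrite mulr1n.
exists ((k + 1)%:~R / 1%:R) => _ [m [n [mg ->]]].
by apply: (@og_cut _ _ _ 0%N) mg _; rewrite mulr1n.
Qed.

Lemma og_ratio_ge (m : int) n g :
  e *~ m <= g *+ n.+1 -> m%:~R / n.+1%:R <= og_ratio g.
Proof.
by move=> mg; apply: sup_upper_bound (og_ratio_has_sup g) _ _; exists m, n.
Qed.

Lemma og_ratio_le (q : int) p g :
  g *+ p.+1 <= e *~ q -> og_ratio g <= q%:~R / p.+1%:R.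
Proof.
move=> gq; apply: ge_sup; first by have [] := og_ratio_has_sup g.
by move=> _ [m [n [mg ->]]]; apply: og_cut mg gq.
Qed.

(** Multiplying by [n] locates the three ratios in intervals with integer
    endpoints, so that the defect of additivity is at most [2 / n]. *)
Lemma og_ratioD g h : og_ratio (g + h) = og_ratio g + og_ratio h.
Proof.
set x := og_ratio (g + h); set y := og_ratio g; set z := og_ratio h.
have bound n : n.+1%:R * `|x - (y + z)| <= 2.
  have [k [kg gk]] := og_floor (g *+ n.+1).
  have [l [lh hl]] := og_floor (h *+ n.+1).
  have N0 : (0 : R) < n.+1%:R by rewrite ltr0Sn.
  have := og_ratio_ge kg; have := og_ratio_le gk.
  have := og_ratio_ge lh; have := og_ratio_le hl.
  have := @og_ratio_ge (k + l) n (g + h).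
  rewrite mulrzDr mulrnDl => /(_ (og_leD kg lh)).
  have := @og_ratio_le (k + 1 + (l + 1)) n (g + h).
  rewrite mulrzDr mulrnDl => /(_ (og_leD gk hl)).
  rewrite -/x -/y -/z.
  rewrite !ler_pdivrMr// !ler_pdivlMr// !intrD.
  rewrite -[X in X * `|_|]gtr0_norm// -normrM ler_norml.
  by move=> h1 h2 h3 h4 h5 h6; apply/andP; split; lra.
apply/eqP; rewrite -subr_eq0 -normr_le0 leNgt; apply/negP => d0.
have := bound (Num.bound (2 / `|x - (y + z)|)); apply/negP; rewrite -ltNge.
rewrite -ltr_pdivrMr//; apply: lt_trans (archi_boundP _) _.
  by rewrite divr_ge0// ltW.
by rewrite ltr_nat.
Qed.

Lemma og_ratio_is_zmod_morphism : zmod_morphism og_ratio.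
Proof.
by move=> g h; rewrite -[in RHS](subrK h g) [in RHS]og_ratioD addrK.
Qed.

Lemma og_ratio_gt0 g : 0 < g -> 0 < og_ratio g.
Proof.
move=> g0; have [[|n] eg] := og_archimedean e g0.
  by rewrite mulr0n lt_gtF in eg.
apply: lt_le_trans (_ : 1%:~R / n.+1%:R <= _).
  by rewrite divr_gt0 ?ltr0Sn// ltr01.
by apply: og_ratio_ge; rewrite mulr1z ltW.
Qed.

Lemma og_ratio_mono : {mono og_ratio : x y / x <= y}.
Proof.
have lt x y : x < y -> og_ratio x < og_ratio y.
  rewrite -og_subr_gt0 => /og_ratio_gt0.
  by rewrite og_ratio_is_zmod_morphism subr_gt0.
move=> x y; apply/idP/idP => [|].
  by apply: contraTT => /og_nle/lt; rewrite -ltNge.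
by rewrite le_eqVlt => /predU1P[->//|/lt/ltW].
Qed.

End Embedding.

Lemma og_embedding : exists f : {additive G -> R}, {mono f : x y / x <= y}.
Proof.
have [[e e0]|no] := pselect (exists e : G, 0 < e).
  pose F := GRing.isZmodMorphism.Build G R (og_ratio e)
    (og_ratio_is_zmod_morphism e0).
  pose f : {additive G -> R} := HB.pack (og_ratio e) F.
  by exists f; apply: og_ratio_mono.
have le0 x : x <= 0 by apply/negPn/negP => /og_nle x0; apply: no; exists x.
have eq0 x : x = 0.
  by apply/le_anti; rewrite le0 -[X in 0 <= X]opprK og_oppr_ge0 le0.
by exists \0 => x y; rewrite (eq0 x) (eq0 y) !lexx.
Qed.

(** Hölder's theorem; completeness passes to the image because the embedding
    reflects the order. *)
Lemma complete_ordered_group_real : isomorphic_to_complete_subgroup R G.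
Proof.
have [f fmono] := og_embedding; exists f; split=> //; split.
  split; first by apply/mem_set; exists 0; rewrite ?raddf0.
  move=> _ _ /set_mem[x _ <-] /set_mem[y _ <-].
  by apply/mem_set; exists (x - y); rewrite ?raddfB.
move=> S SG [s Ss] [_ [b _ <-] Sb].
have [x _ ex] := SG _ Ss.
have [||m [mS mM]] := infG (S := f @^-1` S).
- by exists x; rewrite /preimage /= ex.
- by exists b => y Sy; rewrite -fmono; apply: Sb.
exists (f m); split; first by exists m.
- move=> t St; have [y _ ey] := SG _ St; rewrite -ey fmono; apply: mS.
  by rewrite /preimage /= ey.
- move=> _ [c _ <-] cS; rewrite fmono; apply: mM => y Sy.
  by rewrite -fmono; apply: cS.
Qed.

End CompleteOrderedGroup.

(** * The value group of a domain with totally ordered divisibility *)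

Section FractionFacts.
Variable V : idomainType.

Lemma fraction_numden (x : {fraction V}) :
  exists a b : V, b != 0 /\ x = a%:F / b%:F.
Proof.
elim/quotW: x => r; have r0 := denom_ratioP r.
exists (frac r).1, (frac r).2; split=> //.
apply: (@mulIf _ (frac r).2%:F); first by rewrite tofrac_eq0.
rewrite divfK ?tofrac_eq0//; unlock FracField.tofrac.
rewrite -[LHS]FracField.pi_mul; apply/eqmodP.
by rewrite /= FracField.equivfE /FracField.mulf !numden_Ratio
  ?mulf_neq0 ?oner_eq0// ?mulr1 mulrC.
Qed.

End FractionFacts.

Section ValueGroupFacts.
Variable V : idomainType.
Hypothesis total : forall x y : V, divides x y \/ divides y x.

Lemma divides_total_valuation : valuation_domain V.
Proof.
move=> x x0; have [a [b [b0 ex]]] := fraction_numden x.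
have [[c e]|[c e]] := total b a; [left|right]; exists c; rewrite ex e rmorphM /=.
  by rewrite mulfK ?tofrac_eq0.
have a0 : a != 0 by apply: contraNneq b0 => a0; rewrite e a0 mulr0.
by rewrite invfM invrK mulrCA mulVf ?mulr1 ?tofrac_eq0.
Qed.

Implicit Types (g h b c m : value_group V) (x y z : nzfrac V).

Lemma vg_leP g h : g <= h <-> exists a : V, val (repr h) = a%:F * val (repr g).
Proof. by split=> /asboolP. Qed.

Lemma vg_total g h : g <= h \/ h <= g.
Proof.
set x := val (repr g); set y := val (repr h).
have x0 : x != 0 := nzfrac_neq0 _; have y0 : y != 0 := nzfrac_neq0 _.
have [|[a e]|[a e]] := @divides_total_valuation (y / x).
- by rewrite mulf_neq0// invr_eq0.
- by left; apply/vg_leP; exists a; rewrite -e divfK.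
- by right; apply/vg_leP; exists a; rewrite -e invf_div divfK.
Qed.

Lemma vg_leD2l b g h : g <= h -> b + g <= b + h.
Proof.
move=> /vg_leP[a e]; rewrite -(valueK b) -(valueK g) -(valueK h).
rewrite -![value _ + value _]/(vg_add _ _) !vg_addE.
rewrite -[_ <= _]/(vg_le _ _) vg_leE; apply/asboolP; exists a.
by rewrite /= -[nzfrac_val (repr h)]/(val (repr h)) e mulrCA.
Qed.

(** Relative to a lower bound [b] of [S], the elements of [S] are values of
    elements of [V], and their infimum is the value of the greatest common
    divisor. *)
Lemma vg_inf (S : set (value_group V)) :
  (forall (T : set V) (x : V), T x -> x != 0 ->
    exists d, forall c : V, (forall t, T t -> divides c t) <-> divides c d) ->
  S !=set0 -> (exists b, lbound S b) ->
  exists m, lbound S m /\ forall b, lbound S b -> b <= m.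
Proof.
move=> gcdV [s0 Ss0] [b bS].
pose T := [set t : V | exists2 s, S s & val (repr s) = t%:F * val (repr b)].
have TS s : S s -> exists2 t, T t & val (repr s) = t%:F * val (repr b).
  by move=> Ss; have /vg_leP[t et] := bS _ Ss; exists t => //; exists s.
have nz g : val (repr g) != 0 := nzfrac_neq0 _.
have [t0 Tt0 et0] := TS _ Ss0.
have t00 : t0 != 0.
  by apply: contraNneq (nz s0) => t00; rewrite et0 t00 rmorph0 mul0r.
have [d Hd] := gcdV T t0 Tt0 t00.
have dT t : T t -> divides d t by apply: (Hd d).2; apply: divides_refl.
have d0 : d != 0.
  by have [r e] := dT _ Tt0; apply: contraNneq t00 => d0; rewrite e d0 mulr0.
have dF0 : d%:F != 0 by rewrite tofrac_eq0.
pose m := value (nzfracM (NzFrac dF0) (repr b)).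
have le_m g a : d%:F * val (repr b) = a%:F * val (repr g) -> g <= m.
  move=> e; rewrite -[g <= m]/(vg_le _ _) -(valueK g) vg_leE.
  by apply/asboolP; exists a.
exists m; split=> [s Ss|c cS].
  have [t Tt et] := TS _ Ss; have [r er] := dT _ Tt.
  rewrite -[m <= s]/(vg_le _ _) -(valueK s) vg_leE; apply/asboolP; exists r.
  by rewrite et er rmorphM /= mulrA.
have [cb|/vg_leP[a ea]] := vg_total c b.
  by apply: le_trans cb _; apply: (le_m b d).
have /Hd[r er] : forall t, T t -> divides a t.
  move=> t [s Ss et]; have /vg_leP[r er] := cS _ Ss; exists r.
  by apply/eqP; rewrite -tofrac_eq; apply/eqP/(mulIf (nz b));
    rewrite -et er ea rmorphM mulrA.
by apply: (le_m c r); rewrite er ea rmorphM mulrA.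
Qed.

End ValueGroupFacts.

(** * Invertibility and dimension from the localizations *)

Section Globalization.
Variable D : idomainType.

Lemma proper_ideal1 (I : set D) : Defs.proper_ideal I <-> ideal I /\ ~ I 1.
Proof.
split=> -[iI H]; split=> // I1; last by apply: H; rewrite I1.
apply: H; apply/seteqP; split=> // x _; rewrite -(mulr1 x).
by case: iI => _ _; apply.
Qed.

Lemma exists_maximal_ideal (I : set D) : Defs.proper_ideal I ->
  exists2 M, maximal_ideal M & I `<=` M.
Proof.
move=> /proper_ideal1[iI I1].
(* The empty set is admitted because the empty chain has empty union. *)
pose Q : set (set D) := [set J | J = set0 \/ [/\ ideal J, ~ J 1 & I `<=` J]].
have [F FQ Ftot|M [[M0|[iM M1 IM]] Mmax]] := @Zorn_bigcup _ Q.
- have [[J FJ Jn0]|no] := pselect (exists2 J, F J & J <> set0); last first.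
    left; apply/seteqP; split=> // x [J FJ Jx]; apply: no; exists J => // J0.
    by rewrite J0 in Jx.
  have FQ' K x : F K -> K x -> [/\ ideal K, ~ K 1 & I `<=` K].
    by move=> /FQ[-> []|//].
  have [/Jn0//|[iJ J1 IJ]] := FQ J FJ; right; split.
  + split=> [|x y [K FK Kx] [K' FK' Ky]|a x [K FK Kx]].
    * by exists J => //; case: iJ.
    * have [KK'|K'K] := Ftot _ _ FK FK'.
        exists K' => //; have [[_ KD _] _ _] := FQ' _ _ FK' Ky.
        exact: KD (KK' _ Kx) Ky.
      exists K => //; have [[_ KD _] _ _] := FQ' _ _ FK Kx.
      exact: KD Kx (K'K _ Ky).
    * by exists K => //; have [[_ _ KM] _ _] := FQ' _ _ FK Kx; apply: KM.
  + by move=> [K FK K1]; have [] := FQ' _ _ FK K1.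
  + by move=> x Ix; exists J => //; apply: IJ.
- case: (Mmax I); last by right; split.
  by have [I0 _ _] := iI; rewrite M0; split=> [x []|/(_ 0 I0)[]].
- exists M => //; split; first exact/proper_ideal1.
  move=> J /proper_ideal1[iJ J1] MJ; apply/seteqP; split=> // .
  apply: contrapT => JM; apply: (Mmax J) => //.
  by right; split=> //; apply: subset_trans MJ.
Qed.

(** The inverse of [I = (g_i)] is [J = (D : I)]. The ideal [I J] of [D] lies in
    no maximal ideal [M]: a generator [g_j] of smallest value generates [I]
    locally at [M], hence [s * g_i] is a multiple of [g_j] for some [s] outside
    [M] and all [i], so that [s = g_j * (s / g_j)] is in [I J]. *)
Lemma locally_valuation_prufer :
  (forall (M : set D) (hM : maximal_ideal M)
     (x y : localization (maximal_ideal_prime hM)),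
     divides x y \/ divides y x) ->
  prufer_domain D.
Proof.
move=> total I nI [n [g eI]].
have [i0 gi0] : exists i, g i != 0.
  have [x Ix x0] := nonzero_ideal_elt nI; apply: contrapT => no.
  move: Ix; rewrite eI => -[c ex]; move: x0; rewrite ex big1 ?eqxx// => i _.
  by have [->|gi] := eqVneq (g i) 0; [rewrite mulr0|case: no; exists i].
pose J : set {fraction D} := [set y | forall i, exists a : D, (g i)%:F * y = a%:F].
have J0 : J 0 by move=> i; exists 0; rewrite mulr0 rmorph0.
have JD y z : J y -> J z -> J (y + z).
  move=> Jy Jz i; have [a ea] := Jy i; have [b eb] := Jz i; exists (a + b).
  by rewrite mulrDr ea eb rmorphD.
have JM a y : J y -> J (a%:F * y).
  by move=> Jy i; have [b eb] := Jy i; exists (a * b); rewrite mulrCA eb rmorphM.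
have Ig i : I (g i).
  rewrite eI; exists (fun j => (j == i)%:R).
  rewrite (bigD1 i)//= eqxx mul1r big1 ?addr0// => j /negbTE->.
  by rewrite mul0r.
exists J; first by split=> //; exists (g i0) => // y Jy; apply: Jy.
pose N : set D := [set a | exists2 y : 'I_n -> {fraction D},
  forall i, J (y i) & a%:F = \sum_(i < n) (g i)%:F * y i].
have iN : ideal N.
  split=> [|a b [y Jy ea] [z Jz eb]|c a [y Jy ea]].
  - by exists (fun=> 0) => //; rewrite big1 ?rmorph0// => i _; rewrite mulr0.
  - exists (fun i => y i + z i) => [i|]; first exact: JD.
    by rewrite rmorphD /= ea eb -big_split; apply: eq_bigr => i _; rewrite mulrDr.
  - exists (fun i => c%:F * y i) => [i|]; first exact: JM.
    by rewrite rmorphM /= ea mulr_sumr; apply: eq_bigr => i _; rewrite mulrCA.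
have N1 : N 1.
  apply: contrapT => N1; have [|M hM NM] := @exists_maximal_ideal N.
    exact/proper_ideal1.
  pose hP := maximal_ideal_prime hM.
  have [j Hj] := divides_least (fun i => loc_of hP (g i)) i0 (total M hM).
  have /choice[s Hs] : forall i, exists s, ~ M s /\ divides (g j) (s * g i).
    by move=> i; have /loc_dividesP[s Ms gs] := Hj i; exists s.
  have gj0 : g j != 0.
    have [Ms [c ec]] := Hs i0; apply/eqP => gj0.
    have : s i0 * g i0 != 0; last by rewrite ec gj0 mulr0 eqxx.
    rewrite mulf_neq0//; apply/eqP => si0; apply: Ms; rewrite si0.
    by case: (hM) => -[[]].
  pose p := \prod_(i < n) s i.
  have Mp : ~ M p.
    rewrite /p; elim/big_ind: _ => [|a b|i _]; last by have [] := Hs i.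
      exact: loc_notin1 hP.
    exact: (loc_notinM hP).
  apply/Mp/NM; exists (fun i => if i == j then p%:F / (g j)%:F else 0).
    move=> i; case: eqP => // _ k; have [_ [c ec]] := Hs k.
    exists (c * \prod_(i < n | i != k) s i).
    apply: (@mulIf _ (g j)%:F); first by rewrite tofrac_eq0.
    rewrite -mulrA divfK ?tofrac_eq0// -!rmorphM; congr _%:F.
    by rewrite /p (bigD1 k)//= mulrA [g k * _]mulrC ec mulrAC.
  rewrite (bigD1 j)//= eqxx big1 ?addr0; last by move=> i /negbTE->; rewrite mulr0.
  by rewrite mulrC divfK// tofrac_eq0.
apply/seteqP; split=> [_ [k [a [y [Ia Jy ->]]]]|_ [a _ <-]].
  elim/big_ind: _ => [|_ _ [u _ <-] [v _ <-]|i _].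
  - by exists 0; rewrite ?rmorph0.
  - by exists (u + v); rewrite ?rmorphD.
  have [b Ib <-] := Ia i; move: Ib; rewrite eI => -[c ->].
  have /choice[q eq] := Jy i.
  exists (\sum_j c j * q j) => //; rewrite !rmorph_sum mulr_suml.
  by apply: eq_bigr => l _; rewrite !rmorphM /= -mulrA eq.
have [_ _ /(_ a _ N1)] := iN; rewrite mulr1 => -[y Jy ea].
by exists n, (fun i => (g i)%:F), y; split=> // i; exists (g i).
Qed.

(** In [D_M], a power of any element of [M] is a multiple of a given nonzero
    element [x]; hence a prime below [M] which contains [x] contains [M]. *)
Lemma locally_archimedean_dim1 :
  (forall (M : set D) (hM : maximal_ideal M)
     (x y : localization (maximal_ideal_prime hM)),
     x != 0 -> y \isn't a GRing.unit -> exists n, divides x (y ^+ n)) ->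
  krull_dim_le D 1.
Proof.
move=> arch [P [Pprime Plt]].
pose i1 : 'I_3 := Ordinal (isT : (1 < 3)%N).
have [P01 /existsNP[x /not_implyP[P1x P0x]]] := Plt ord0 i1 isT.
have [P12 /existsNP[y /not_implyP[P2y P1y]]] := Plt i1 ord_max isT.
have [M hM PM] := exists_maximal_ideal (Pprime ord_max).1.
pose hP := maximal_ideal_prime hM.
have x0 : x != 0.
  by apply: contra_notN P0x => /eqP ->; case: (Pprime ord0) => -[[]].
have [||n] := arch M hM (loc_of hP x) (loc_of hP y).
- by rewrite -(rmorph0 (loc_of _)) (inj_eq (@loc_of_inj _ _ _)).
- apply/negP => /(loc_unitE (loc_notin1 hP)); rewrite rmorph1 mulr1.
  by move=> /(_ y erefl); apply; apply: PM.
rewrite -rmorphXn => /loc_dividesP[s Ms [c e]].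
have [[[P10 _ P1M] P1T] P1prime] := Pprime i1.
have : P i1 (s * y ^+ n) by rewrite e; apply: P1M.
move=> /P1prime[/P12/PM//|]; elim: n {e} => [|n IH].
  by have [+ _] := Pprime i1 => /proper_ideal1[].
by rewrite exprS => /P1prime[].
Qed.

End Globalization.

Theorem theorem11 (R : realType) (D : idomainType) (hD : sharp_domain D) :
  (forall (M : set D) (hM : maximal_ideal M),
     valuation_domain (localization (maximal_ideal_prime hM)) /\
     isomorphic_to_complete_subgroup R
       (value_group (localization (maximal_ideal_prime hM)))) /\
  (prufer_domain D /\ krull_dim_le D 1).
Proof.
have sharp M hM := @loc_sharp D M (maximal_ideal_prime hM) hD.
have local M hM := @loc_local D M (maximal_ideal_prime hM).
have total M hM := divides_total (sharp M hM) (local M hM).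
split=> [M hM|].
  split; first exact: divides_total_valuation.
  apply: complete_ordered_group_real => [g h|b g h|S].
  - exact: vg_total (total M hM) g h.
  - exact: vg_leD2l.
  - by apply: vg_inf => // T x; apply: setgcd_exists.
split; first by apply: locally_valuation_prufer => M hM; apply: total.
apply: locally_archimedean_dim1 => M hM x y.
exact: (divides_exp (sharp M hM) (local M hM)).
Qed.
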